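(* Let $k\geq 2$ be an integer. For all integers $n\geq 3k$, $$ar(n, kC_{3})\geq\max\left\{\binom{3k-1}{2}+n-3k+1,\ \left\lfloor\frac{(n-k+2)^{2}}{4}\right\rfloor+(k-2)(n-k+2)+\binom{k-2}{2}+1\right\}.$$
   Context: An edge-coloring of a graph assigns a color to each edge; an edge-colored graph is rainbow if all colors on its edges are distinct. For a positive integer $n$ and a graph $F$, the anti-Ramsey number $ar(n,F)$ is the maximum number of colors in an edge-coloring of the complete graph $K_n$ containing no rainbow copy of $F$. $kC_3$ denotes the graph consisting of $k$ vertex-disjoint triangles. *)

(* Defs.v *)
From mathcomp Require Import all_boot.

Set Implicit Arguments.
Unset Strict Implicit.
Unset Printing Implicit Defensive.

Record sgraph := SGraph {
  vertex :> finType;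
  adj : rel vertex;
  adj_sym : symmetric adj;
  adj_irr : irreflexive adj
}.

Definition edges (G : sgraph) : {set {set G}} :=
  [set [set p.1; p.2] | p : G * G & adj p.1 p.2].

Lemma neq_sym (T : finType) : symmetric (fun x y : T => x != y).
Proof. by move=> x y; rewrite eq_sym. Qed.

Lemma neq_irr (T : finType) : irreflexive (fun x y : T => x != y).
Proof. by move=> x; rewrite eqxx. Qed.

Definition complete (n : nat) : sgraph :=
  SGraph (@neq_sym 'I_n) (@neq_irr 'I_n).

Definition copies_adj (k : nat) (G : sgraph) : rel ('I_k * G) :=
  fun u v => (u.1 == v.1) && adj u.2 v.2.

Lemma copies_sym k G : symmetric (@copies_adj k G).
Proof. by move=> u v; rewrite /copies_adj eq_sym adj_sym. Qed.

Lemma copies_irr k G : irreflexive (@copies_adj k G).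
Proof. by move=> u; rewrite /copies_adj adj_irr andbF. Qed.

Definition copies (k : nat) (G : sgraph) : sgraph :=
  SGraph (@copies_sym k G) (@copies_irr k G).

Definition triangle : sgraph := complete 3.

(* S is the edge set of a (not necessarily induced) copy of F in H. *)
Definition is_copy (F H : sgraph) (S : {set {set H}}) : bool :=
  (S \subset edges H) &&
  [exists f : {ffun F -> H},
     injectiveb f && (S == [set f @: e | e : {set F} in edges F])].

(* An edge-coloring of H is given by a function on all sets of vertices; only
   its values on edges H are ever used. *)
Definition rainbow (H : sgraph) (C : finType) (c : {set H} -> C)
    (S : {set {set H}}) : bool :=
  dinjectiveb c S.

Definition has_rainbow_copy (F H : sgraph) (C : finType) (c : {set H} -> C) :
    bool :=
  [exists S : {set {set H}}, is_copy F S && rainbow c S].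

Definition num_colors (H : sgraph) (C : finType) (c : {set H} -> C) : nat :=
  #|c @: edges H|.

(* A coloring of K_n uses at most 'C(n, 2) colors, so a palette of that size
   loses nothing (see leq_ar and ar_attained); the extra color keeps the
   palette nonempty when n < 2.  The value is 0 when every coloring of K_n has
   a rainbow copy of F, in which case the maximum does not exist. *)
Definition ar (n : nat) (F : sgraph) : nat :=
  \max_(c : {ffun {set complete n} -> 'I_('C(n, 2).+1)}
          | ~~ has_rainbow_copy F c) num_colors c.

Lemma card_edges_complete (n : nat) : #|edges (complete n)| = 'C(n, 2).
Proof.
rewrite -[in RHS](card_ord n) -card_draws; apply: eq_card => e.
rewrite !inE; apply/imsetP/idP => [[[x y] /=]|/cards2P [x [y [xy ->]]]].
  by rewrite inE /= => xy ->; rewrite cards2 xy.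
by exists (x, y); rewrite ?inE.
Qed.

Lemma recolor (n : nat) (F : sgraph) (C : finType)
    (c : {set complete n} -> C) :
  ~~ has_rainbow_copy F c ->
  exists2 d : {ffun {set complete n} -> 'I_('C(n, 2).+1)},
    ~~ has_rainbow_copy F d & num_colors d = num_colors c.
Proof.
move=> nc; pose E := edges (complete n).
pose g x : 'I_('C(n, 2).+1) := inord (index x (enum (c @: E))).
pose d := [ffun e : {set complete n} => g (c e)].
have leE : #|c @: E| <= 'C(n, 2).
  by rewrite -card_edges_complete leq_imset_card.
have ginj : {in c @: E &, injective g}.
  move=> x y xE yE /(congr1 val); rewrite /= !inordK ?ltnS.
  - by apply: (index_inj x); rewrite mem_enum.
  - by apply: leq_trans leE; rewrite cardE index_size.
  - by apply: leq_trans leE; rewrite cardE index_size.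
have dE : d @: E = g @: (c @: E).
  by rewrite -[RHS]imset_comp; apply: eq_imset => e; rewrite ffunE.
exists d; last by rewrite /num_colors -/E dE card_in_imset.
apply: contra nc => /existsP[S /andP[SF /dinjectiveP Sr]].
apply/existsP; exists S; rewrite SF; apply/dinjectiveP => e e' eS e'S cc.
by apply: Sr => //; rewrite !ffunE cc.
Qed.

Lemma leq_ar (n : nat) (F : sgraph) (C : finType)
    (c : {set complete n} -> C) :
  ~~ has_rainbow_copy F c -> num_colors c <= ar n F.
Proof.
move=> /recolor[d nd <-].
by rewrite /ar (bigD1 d) //= leq_maxl.
Qed.

Lemma ar_attained (n : nat) (F : sgraph) (C : finType)
    (c : {set complete n} -> C) :
  ~~ has_rainbow_copy F c ->
  exists2 d : {ffun {set complete n} -> 'I_('C(n, 2).+1)},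
    ~~ has_rainbow_copy F d & num_colors d = ar n F.
Proof.
move=> /recolor[d nd _].
pose A := [pred d : {ffun {set complete n} -> 'I_('C(n, 2).+1)} |
  ~~ has_rainbow_copy F d].
have A_gt0 : 0 < #|A| by apply/card_gt0P; exists d.
have [d' dA dE] := eq_bigmax_cond (fun d : {ffun _ -> _} => num_colors d) A_gt0.
by exists d'.
Qed.

(* Main.v *)
(** Both bounds come from explicit colorings of K_n.

    For the first, the edges inside the first 3k-1 vertices get pairwise
    distinct colors, and every other edge is colored by its larger endpoint.
    A copy of kC_3 has 3k vertices, so its largest vertex lies outside the
    clique, and the two edges of its triangle at that vertex share a color.

    For the second, split the vertices into A, B, C with |A| = k-2 and B, C
    of nearly equal sizes.  The edges inside B or inside C all get one color,
    the others get distinct private colors.  At least two of k disjoint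
    triangles avoid A, and each of those has, by pigeonhole, an edge inside
    B or inside C. *)

Require Import Defs.
From mathcomp Require Import all_boot.
From mathcomp Require Import zify.

Set Implicit Arguments.
Unset Strict Implicit.
Unset Printing Implicit Defensive.

Lemma mem_edges_complete (n : nat) (e : {set complete n}) :
  (e \in edges (complete n)) = (#|e| == 2).
Proof.
apply/imsetP/cards2P => [[[x y] /= xy ->]|[x [y [xy ->]]]].
  by exists x, y; rewrite inE in xy.
by exists (x, y); rewrite ?inE.
Qed.

Lemma mem_edges_copies (k m : nat) (i : 'I_k) (j j' : 'I_m) :
  j != j' -> [set (i, j); (i, j')] \in edges (copies k (complete m)).
Proof.
by move=> jj'; apply/imsetP; exists ((i, j), (i, j')); rewrite //= inE /= /copies_adj eqxx.
Qed.

(** Trades the edge set of the copy for an embedding [f]. The indices [i] and [l] may differ, so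
    edges of two different components can be compared. *)
Lemma rainbow_copiesP (k m n : nat) (C : finType) (c : {set complete n} -> C) :
  has_rainbow_copy (copies k (complete m)) c ->
  exists2 f : 'I_k * 'I_m -> 'I_n, injective f &
    forall i j j' l h h', j != j' -> h != h' ->
      c [set f (i, j); f (i, j')] = c [set f (l, h); f (l, h')] ->
      [set f (i, j); f (i, j')] = [set f (l, h); f (l, h')].
Proof.
case/existsP=> S /andP[/andP[_ /existsP[f /andP[/injectiveP injf /eqP defS]]]].
move=> /dinjectiveP injc; exists f => // i j j' l h h' jj' hh'.
have edgeS i0 j0 j1 : j0 != j1 -> [set f (i0, j0); f (i0, j1)] \in S.
  move=> jj1; rewrite defS; apply/imsetP.
  by exists [set (i0, j0); (i0, j1)]; rewrite ?mem_edges_copies ?imsetU1 ?imset_set1.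
by move=> ?; apply: injc => //; apply: edgeS.
Qed.

Lemma card_ord_lt (n a : nat) : a <= n -> #|[set i : 'I_n | i < a]| = a.
Proof.
move=> le_an; rewrite -sum1_card -[RHS]card_ord -[RHS]sum1_card.
by rewrite (big_ord_widen _ (fun=> 1) le_an); apply: eq_bigl => i; rewrite inE.
Qed.

Lemma bin2D (a b : nat) : 'C(a + b, 2) = 'C(a, 2) + 'C(b, 2) + a * b.
Proof.
elim: a => [|a IHa]; first by rewrite mul0n addn0.
by rewrite addSn !(binS _ 1) !bin1 IHa mulSn; lia.
Qed.

(** The floor in the second bound counts the edges between two parts of sizes [m./2] and
    [uphalf m]. *)
Lemma uphalf_mul_half (m : nat) : m ^ 2 %/ 4 = m./2 * uphalf m.
Proof.
rewrite uphalf_half -{1}[m]odd_double_half -muln2.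
by case: (odd m); lia.
Qed.

Section CliqueColoring.

Variables (n a : nat).

(** The sum type keeps the private colors of clique edges apart from the vertex colors; [inord]
    needs the nonempty type ['I_n.+1]. *)
Definition clique_coloring (e : {set complete n}) : {set 'I_n} + 'I_n.+1 :=
  if e \subset [set i : 'I_n | i < a] then inl e
  else inr (inord (\max_(i in e) i)).

Lemma clique_coloring_max (x v : complete n) : x < v -> a <= v ->
  clique_coloring [set v; x] = inr (inord v).
Proof.
move=> lt_xv le_av; rewrite /clique_coloring subUset !sub1set !inE ltnNge le_av /=.
rewrite big_setU1 ?big_set1 ?inE; last by rewrite -val_eqE /= gtn_eqF.
by rewrite /= (maxn_idPl (ltnW lt_xv)).
Qed.

Lemma num_colors_clique_coloring : 0 < a <= n ->
  'C(a, 2) + (n - a) <= num_colors clique_coloring.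
Proof.
case/andP=> a_gt0 le_an; rewrite /num_colors.
pose A := [set i : 'I_n | i < a].
pose D := [set e : {set 'I_n} | e \subset A & #|e| == 2].
pose w := fun v : 'I_n => inord v : 'I_n.+1.
have cardA : #|A| = a by apply: card_ord_lt.
have injw : injective w.
  by move=> x y /(congr1 val); rewrite /= !inordK ?ltnS ?(ltnW (ltn_ord _)) // => /val_inj.
have subI : (inl @: D) :|: (inr @: (w @: ~: A)) \subset
    clique_coloring @: edges (complete n).
  apply/subsetP => z /setUP[/imsetP[e eD]|/imsetP[_ /imsetP[v vA ->]]] ->{z}.
    move: eD; rewrite inE => /andP[eA e2].
    apply/imsetP; exists e; first by rewrite mem_edges_complete.
    by rewrite /clique_coloring eA.
  rewrite !inE -leqNgt in vA.
  have v_gt0 : 0 < v by apply: leq_trans vA.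
  (* Vertex 0 lies below every [v >= a], so its edge to [v] realizes the color of [v]. *)
  apply/imsetP; exists [set v; Ordinal (leq_trans a_gt0 le_an)].
    by rewrite mem_edges_complete cards2 -val_eqE /= (gtn_eqF v_gt0).
  by rewrite clique_coloring_max.
apply: leq_trans (subset_leq_card subI); rewrite cardsU.
have -> : (inl @: D) :&: (inr @: (w @: ~: A)) = set0 :> {set {set 'I_n} + 'I_n.+1}.
  by apply/setP => z; rewrite !inE; apply/andP => -[/imsetP[? _ ->] /imsetP[]].
rewrite cards0 subn0 !card_imset //; try by move=> ? ? [].
by rewrite cards_draws [#|~: _|]cardsCs setCK cardA card_ord.
Qed.

Lemma clique_coloring_not_rainbow (k : nat) : a < 3 * k ->
  ~~ has_rainbow_copy (copies k triangle) clique_coloring.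
Proof.
move=> lt_ak; apply/negP => /rainbow_copiesP[f injf rbf].
have k_gt0 : 0 < k by lia.
pose u0 : 'I_k * 'I_3 := (Ordinal k_gt0, ord0).
case: (arg_maxnP (fun u => f u : nat) (isT : xpredT u0)) => [[i j] _ maxf].
(* Otherwise all [3 * k] vertices of the copy would fit below [a]. *)
have le_af : a <= f (i, j).
  rewrite leqNgt; apply: contraL lt_ak => lt_fa; rewrite -leqNgt.
  have inA : f @: [set: 'I_k * 'I_3] \subset [set x : 'I_n | x < (f (i, j)).+1].
    by apply/subsetP => _ /imsetP[u _ ->]; rewrite inE ltnS; apply: maxf.
  have := subset_leq_card inA.
  rewrite card_imset // cardsT card_prod !card_ord card_ord_lt ?ltn_ord //.
  by lia.
have col j' : j' != j -> clique_coloring [set f (i, j); f (i, j')] = inr (inord (f (i, j))).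
  move=> jj'; apply: clique_coloring_max => //.
  rewrite ltn_neqAle [_ <= _]maxf // andbT val_eqE.
  by apply: contra jj' => /eqP /injf [->].
have [h [h' [hj h'j hh']]] : exists h h' : 'I_3, [/\ h != j, h' != j & h != h'].
  have /cards2P[h [h' [hh' Dj]]] : #|[set~ j]| == 2.
    by rewrite cardsC1 card_ord.
  exists h, h'; split=> //.
    by have := set21 h h'; rewrite -Dj !inE.
  by have := set22 h h'; rewrite -Dj !inE.
have := rbf i j h i j h'; rewrite ![j == _]eq_sym (col h) ?(col h') //.
(* The two edges at the largest vertex differ: [f (i, h)] lies only in the first. *)
move=> /(_ hj h'j erefl) /setP/(_ (f (i, h))); rewrite !inE eqxx orbT.
by rewrite !(inj_eq injf) !xpair_eqE eqxx (negPf hj) (negPf hh').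
Qed.

End CliqueColoring.

Section SplitColoring.

Variables (n : nat) (A B : {set 'I_n}).

Definition monochromatic_part (e : {set 'I_n}) : bool :=
  (e \subset B) || (e \subset ~: (A :|: B)).

Definition split_coloring (e : {set complete n}) : option {set 'I_n} :=
  if monochromatic_part e then None else Some e.

Lemma num_colors_split_coloring : [disjoint A & B] -> 1 < #|B| ->
  #|B| * (n - #|A| - #|B|) + #|A| * (n - #|A|) + 'C(#|A|, 2) + 1 <=
  num_colors split_coloring.
Proof.
move=> disAB B_gt1; rewrite /num_colors.
pose D := [set e in edges (complete n) | ~~ monochromatic_part e].
pose P (S : {set 'I_n}) := [set e : {set 'I_n} | e \subset S & #|e| == 2].
have subI : None |: (Some @: D) \subset split_coloring @: edges (complete n).
  apply/subsetP => z /setU1P[->|/imsetP[e]].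
    have /card_gt1P[x [y [xB yB xy]]] := B_gt1.
    apply/imsetP; exists [set x; y]; first by rewrite mem_edges_complete cards2 xy.
    by rewrite /split_coloring /monochromatic_part subUset !sub1set xB yB.
  rewrite inE => /andP[eE eP] ->; apply/imsetP; exists e => //.
  by rewrite /split_coloring (negPf eP).
apply: leq_trans (subset_leq_card subI).
rewrite cardsU1 card_imset; last by move=> ? ? [].
have -> : None \notin Some @: D by apply/imsetP => -[].
rewrite addnC leq_add2l.
(* [D] is bounded below by complement: writing [n] as the sum of the three part sizes in ['C(n, 2)],
   the pairs inside [B] and inside the third part cancel. *)
have coverE : edges (complete n) \subset D :|: (P B :|: P (~: (A :|: B))).
  apply/subsetP => e eE; rewrite !inE eE /= -mem_edges_complete eE !andbT.
  by rewrite orNb.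
have cardAB : #|A :|: B| = #|A| + #|B|.
  by rewrite cardsU disjoint_setI0 // cards0 subn0.
have := subset_leq_card coverE.
have leU (T : finType) (X Y : {set T}) : #|X :|: Y| <= #|X| + #|Y|.
  by rewrite cardsU leq_subr.
move/leq_trans/(_ (leU _ _ _)) => /leq_trans H.
have {}H := H _ (leq_add (leqnn _) (leU _ _ _)).
rewrite card_edges_complete /P !cards_draws in H.
have := cardsC (A :|: B); rewrite cardAB card_ord => defn.
rewrite -{1}defn !bin2D in H.
have -> : n - #|A| - #|B| = #|~: (A :|: B)| by lia.
have -> : n - #|A| = #|B| + #|~: (A :|: B)| by lia.
move: #|A| #|B| #|~: _| #|D| H => p q r d; lia.
Qed.

Lemma monochromatic_edge (g : 'I_3 -> 'I_n) : (forall j, g j \notin A) ->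
  exists j j', j != j' /\ monochromatic_part [set g j; g j'].
Proof.
move=> gA.
have /injectivePn[j [j' jj' eqg]] : ~~ injectiveb (fun j => g j \in B).
  by apply/negP => /injectiveP/leq_card; rewrite card_bool card_ord.
exists j, j'; split=> //.
rewrite /monochromatic_part !subUset !sub1set !inE !negb_or !gA -eqg /=.
by case: (_ \in B).
Qed.

Lemma split_coloring_not_rainbow (k : nat) : #|A| + 2 <= k ->
  ~~ has_rainbow_copy (copies k triangle) split_coloring.
Proof.
move=> le_Ak; apply/negP => /rainbow_copiesP[f injf rbf].
(* [T] indexes the triangles that meet [A]. Distinct triangles use distinct vertices of [A], so at
   least two indices lie outside [T]. *)
pose T := [set u.1 | u in f @^-1: A].
have leT : #|T| <= #|A|.
  apply: leq_trans (leq_imset_card _ _) _; rewrite -(card_imset _ injf).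
  by apply/subset_leq_card/subsetP => _ /imsetP[u uA ->]; rewrite inE in uA.
have /card_gt1P[i [l [iT lT il]]] : 1 < #|~: T|.
  by have := cardsC T; rewrite card_ord; lia.
have avoid i0 : i0 \in ~: T -> forall j, f (i0, j) \notin A.
  rewrite inE => i0T j; apply: contra i0T => fA.
  by apply/imsetP; exists (i0, j); rewrite ?inE.
have [j [j' [jj' mj]]] := monochromatic_edge (avoid _ iT).
have [h [h' [hh' mh]]] := monochromatic_edge (avoid _ lT).
have := rbf i j j' l h h' jj' hh'; rewrite /split_coloring mj mh => /(_ erefl).
move=> /setP/(_ (f (i, j))); rewrite !inE eqxx !(inj_eq injf) !xpair_eqE.
by rewrite (negPf il).
Qed.

End SplitColoring.

Theorem theorem1p1 (k : nat) (hk : 2 <= k) (n : nat) (hn : 3 * k <= n) :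
  maxn ('C(3 * k - 1, 2) + (n - 3 * k) + 1)
       ((n - k + 2) ^ 2 %/ 4 + (k - 2) * (n - k + 2) + 'C(k - 2, 2) + 1)
    <= ar n (copies k triangle).
Proof.
rewrite geq_max; apply/andP; split.
  (* With [a = 3 * k - 1], the [n - a] vertex colors number [(n - 3 * k) + 1]. *)
  apply: leq_trans (leq_ar (@clique_coloring_not_rainbow n (3 * k - 1) k _)); last by lia.
  apply: leq_trans (num_colors_clique_coloring _); lia.
(* [m] is the number of vertices outside [A], and [b] the size of the smaller half. From [4 <= m]
   follows [2 <= b], so [B] contains an edge and the shared color occurs. *)
set m := n - k + 2; pose b := m./2.
have m_ge4 : 4 <= m by rewrite /m; lia.
have halfm : b + uphalf m = m by rewrite /b; lia.
pose A := [set i : 'I_n | i < k - 2].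
pose B := [set i : 'I_n | i < k - 2 + b] :\: A.
have cardA : #|A| = k - 2 by apply: card_ord_lt; lia.
have cardB : #|B| = b.
  rewrite cardsD (setIidPr _) ?cardA ?card_ord_lt; first by lia.
    by rewrite /m in halfm; lia.
  by apply/subsetP => i; rewrite !inE; lia.
apply: leq_trans (leq_ar (@split_coloring_not_rainbow n A B k _)); last by rewrite cardA; lia.
apply: leq_trans (num_colors_split_coloring _ _).
- rewrite cardA cardB uphalf_mul_half -/b.
  have -> : n - (k - 2) = m by rewrite /m; lia.
  by have -> : m - b = uphalf m by lia.
- by rewrite disjoint_sym disjoints_subset subsetDr.
- by rewrite cardB /b; lia.
Qed.
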